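(* Let $H$ be a complex, separable, infinite-dimensional Hilbert space and let $\{f_k\}_{k\in I}$ ($I$ countable) be a Riesz frame for $H$. Then there exist $N\in\mathbb{N}$, vectors $\varphi_1,\dots,\varphi_N\in H$ and operators $T_1,\dots,T_N\in B(H)$ such that $$\{f_k\}_{k\in I}=\bigcup_{1\le i\le N}\{T_i^n\varphi_i\}_{n\ge0}$$ as sets of vectors.
   Context: A family $\{f_n\}_{n\in I}$ ($I$ countable) in $H$ is a frame for $H$ if there are constants $0<C_1\le C_2$ with $C_1\|f\|^2\le\sum_{n\in I}|\langle f,f_n\rangle|^2\le C_2\|f\|^2$ for all $f\in H$; it is a frame sequence if it is a frame for its closed linear span. A frame $\{f_n\}_{n\in I}$ is a Riesz frame if there are constants $0<C_1\le C_2$ such that for every $J\subset I$ the family $\{f_n\}_{n\in J}$ is a frame sequence with frame bounds $C_1,C_2$. $B(H)$ denotes the bounded linear operators on $H$. *)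

(* Defs.v *)
From HB Require Import structures.
From mathcomp Require Import all_boot all_order all_algebra.
From mathcomp Require Import sesquilinear.
From mathcomp Require Import complex.
From mathcomp Require Import all_classical all_reals all_analysis.

Set Implicit Arguments.
Unset Strict Implicit.
Unset Printing Implicit Defensive.

Import Order.TTheory GRing.Theory Num.Theory.
Import numFieldNormedType.Exports.

Local Open Scope complex_scope.
Local Open Scope classical_set_scope.
Local Open Scope ring_scope.

(* Norms over R[i] take values in R[i] (with zero imaginary part); rnorm is
   the same number seen in R. It applies to vectors and to complex scalars. *)
Definition rnorm (R : realType) (V : normedZmodType R[i]) (x : V) : R :=
  complex.Re `|x|.

Definition lspan (R : realType) (H : lmodType R[i]) (A : set H) : set H :=
  [set h | exists (n : nat) (c : 'I_n -> R[i]) (v : 'I_n -> H),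
     (forall i, A (v i)) /\ h = \sum_(i < n) c i *: v i].

Definition infinite_dimensional (R : realType) (H : lmodType R[i]) : Prop :=
  forall s : seq H, lspan [set` s] <> [set: H].

Definition separable_space (T : topologicalType) : Prop :=
  exists2 D : set T, countable D & dense D.

Definition bounded_operator (R : realType) (H : normedModType R[i])
    (T : {linear H -> H}) : Prop :=
  exists M : R, forall x : H, rnorm (T x) <= M * rnorm x.

Section Frames.
Variables (R : realType) (H : normedModType R[i]).
(* Positive definite hermitian form, linear in its first argument. *)
Variable dot : {dot H for @Num.conj R[i]}.
Variables (I : countType) (f : I -> H).

(* The sum is the unordered sum of nonnegative terms, with values in \bar R,
   so the upper bound includes its convergence. *)
Definition frame_bounds (V : set H) (J : set I) (C1 C2 : R) : Prop :=
  forall h : H, V h ->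
    ((C1 * rnorm h ^+ 2)%:E <= \esum_(n in J) (rnorm (dot h (f n)) ^+ 2)%:E)%E
    /\ (\esum_(n in J) (rnorm (dot h (f n)) ^+ 2)%:E
          <= (C2 * rnorm h ^+ 2)%:E)%E.

Definition frame : Prop :=
  exists C1 C2 : R, 0 < C1 <= C2 /\ frame_bounds [set: H] [set: I] C1 C2.

Definition frame_sequence_with_bounds (J : set I) (C1 C2 : R) : Prop :=
  frame_bounds (closure (lspan (f @` J))) J C1 C2.

Definition riesz_frame : Prop :=
  frame /\
  exists C1 C2 : R, 0 < C1 <= C2 /\
    forall J : set I, frame_sequence_with_bounds J C1 C2.

End Frames.

Definition orbit_of (H : Type) (T : H -> H) (phi : H) : set H :=
  range (fun n : nat => iter n T phi).

(* Main.v *)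
Require Import Defs.
From HB Require Import structures.
From mathcomp Require Import all_boot all_order all_algebra.
From mathcomp Require Import sesquilinear.
From mathcomp Require Import complex.
From mathcomp Require Import all_classical all_reals all_analysis.
From mathcomp Require Import ring.
Import numFieldNormedType.Exports.
Import Order.TTheory GRing.Theory Num.Theory.
Local Open Scope complex_scope.
Local Open Scope classical_set_scope.
Local Open Scope ring_scope.

(** A linearly independent frame sequence whose finite subfamilies all share its
    frame bounds is a Riesz sequence, and along a Riesz sequence the shift is
    bounded. The proof cuts the frame into finitely many independent pieces and
    shifts along each of them.

    Cutting. Enumerate a set A of indices and keep those k in A for which f k
    is not in the span of the vectors that come before it ([sieve]). The kept
    family is independent ([sieve_free]) and still spans every f k with k in A
    ([sieve_span]). Remove it, sieve what is left, and so on. If a vector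
    x = f k survives m rounds, it lies in the span of each of the m disjoint
    pieces removed so far, and the lower bound C1 on each piece gives
    m C1 |x|^2 <= sum_n |<x, f n>|^2 <= C2 |x|^2. So only zero vectors survive
    more than C2 / C1 rounds ([residue_zero]). It matters here that C1 is the
    same for all subfamilies.

    Shifting. A finite piece is a union of orbits of the identity. Let g
    enumerate an infinite one. For an independent finite family the lower frame
    bound is a lower Riesz bound ([free_lower_riesz]), and the upper frame bound
    is an upper Riesz bound ([bessel_synthesis]), hence
    |sum_i c_i f (g (i+1))|^2 <= (C2 / C1) |sum_i c_i f (g i)|^2. By
    [bounded_factorization] there is then a bounded operator on all of H with
    f (g i) |-> f (g (i+1)), and the piece is the orbit of f (g 0)
    ([sieve_orbit]). *)

Set Implicit Arguments.
Unset Strict Implicit.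
Unset Printing Implicit Defensive.

(** * Linear spans *)

Section LinearSpan.
Context {R : realType} {V : lmodType R[i]}.
Implicit Types (A B : set V) (x y : V).

Lemma lspan_gen A x : A x -> lspan A x.
Proof.
move=> Ax; exists 1, (fun=> 1), (fun=> x).
by rewrite big_ord1 scale1r; split.
Qed.

Lemma lspan0 A : lspan A 0.
Proof.
by exists 0, (fun=> 0), (fun=> 0); rewrite big_ord0; split => // -[].
Qed.

Lemma lspanD A x y : lspan A x -> lspan A y -> lspan A (x + y).
Proof.
move=> [m [c [v [Av ->]]]] [n [d [w [Aw ->]]]]; exists (m + n)%N.
exists (fun i => match fintype.split i with inl j => c j | inr j => d j end).
exists (fun i => match fintype.split i with inl j => v j | inr j => w j end).
split=> [i|]; first by case: (fintype.split i).
rewrite big_split_ord/=; congr (_ + _); apply: eq_bigr => i _.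
  by rewrite (unsplitK (inl i)).
by rewrite (unsplitK (inr i)).
Qed.

Lemma lspanZ A a x : lspan A x -> lspan A (a *: x).
Proof.
move=> [m [c [v [Av ->]]]]; exists m, (fun i => a * c i), v; split=> //.
by rewrite scaler_sumr; apply: eq_bigr => i _; rewrite scalerA.
Qed.

Lemma lspan_sum A (J : finType) (P : pred J) (F : J -> V) :
  (forall j, P j -> lspan A (F j)) -> lspan A (\sum_(j | P j) F j).
Proof. by move=> AF; apply: big_ind => //; [exact: lspan0|exact: lspanD]. Qed.

Lemma lspan_sub A B : A `<=` lspan B -> lspan A `<=` lspan B.
Proof.
move=> AB _ [n [c [v [Av ->]]]]; apply: lspan_sum => j _.
by apply: lspanZ; apply: AB.
Qed.

End LinearSpan.

(** * Extracting a linearly independent subfamily with the same span *)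

Section Sieve.
Context {R : realType} {V : lmodType R[i]} {I : countType}.
Variable f : I -> V.

(** The elements of A that a greedy choice of independent vectors retains when
    I is run through in the order given by [pickle]. *)
Definition sieve (A : set I) : set I :=
  [set k | A k /\
     ~ lspan (f @` [set j | A j /\ (pickle j < pickle k)%N]) (f k)].

(** Strong induction along [pickle]: a rejected vector is a combination of
    earlier vectors, which the retained ones span already. *)
Lemma sieve_span A k : A k -> lspan (f @` sieve A) (f k).
Proof.
have [n] := ubnP (pickle k); elim: n => // n IHn in k * => lekn Ak.
have [fk|fk] := pselect (lspan (f @` [set j | A j /\ (pickle j < pickle k)%N])
  (f k)); last by apply: lspan_gen; exists k.
move: fk; apply: lspan_sub => _ [j [Aj jk] <-].
by apply: IHn => //; apply: leq_trans jk _.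
Qed.

(** In a nontrivial relation, the last index with a nonzero coefficient carries
    a vector that depends on earlier ones, so it was rejected. *)
Lemma sieve_free A n (k : 'I_n -> I) (c : 'I_n -> R[i]) :
    injective k -> (forall i, sieve A (k i)) ->
  \sum_(i < n) c i *: f (k i) = 0 -> forall i, c i = 0.
Proof.
move=> kinj Ak c0 i0; apply/eqP; apply: contraT => ci0.
pose i := [arg max_(i > i0 | c i != 0%R) pickle (k i)]%N.
have [ci imax] : c i != 0 /\
    forall j, c j != 0 -> (pickle (k j) <= pickle (k i))%N.
  by rewrite /i; case: arg_maxnP.
have [_] := Ak i; case.
move/eqP: c0; rewrite (bigD1 i)//= addr_eq0.
move=> /eqP/(congr1 (fun x => (c i)^-1 *: x)).
rewrite scalerA mulVf// scale1r => ->.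
apply: lspanZ; rewrite -scaleN1r.
apply: lspanZ; apply: lspan_sum => j ji.
have [->|cj] := eqVneq (c j) 0; first by rewrite scale0r; exact: lspan0.
apply: lspanZ; apply: lspan_gen; exists (k j) => //.
split; first by have [] := Ak j.
rewrite ltn_neqAle imax// andbT; apply: contra ji => /eqP/(pcan_inj pickleK).
by move/kinj => ->.
Qed.

End Sieve.

(** * Finite unions of orbits *)

Section OrbitUnion.
Context {R : realType} {H : normedModType R[i]}.

Definition orbit_union (S : set H) : Prop :=
  exists (N : nat) (phi : 'I_N -> H) (T : 'I_N -> {linear H -> H}),
    (forall i : 'I_N, bounded_operator (T i)) /\
    S = \bigcup_(i in [set: 'I_N]) orbit_of (T i) (phi i).

Lemma orbit_union0 : orbit_union set0.
Proof.
exists 0, (fun=> 0), (fun=> idfun); split; first by case.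
by apply/seteqP; split=> // x [[]].
Qed.

Lemma orbit_unionU S1 S2 :
  orbit_union S1 -> orbit_union S2 -> orbit_union (S1 `|` S2).
Proof.
move=> [m [phi [T [bT ->]]]] [n [psi [U [bU ->]]]]; exists (m + n)%N.
exists (fun i =>
  match fintype.split i with inl j => phi j | inr j => psi j end).
exists (fun i => match fintype.split i with inl j => T j | inr j => U j end).
split=> [i|]; first by case: (fintype.split i).
apply/seteqP; split=> [x [[i _ xi]|[i _ xi]]|x [i _]].
- by exists (lshift n i); rewrite // (unsplitK (inl i)).
- by exists (rshift m i); rewrite // (unsplitK (inr i)).
- by case: (fintype.split i) => j xj; [left|right]; exists j.
Qed.

Lemma orbit_union_single (phi : H) (T : {linear H -> H}) :
  bounded_operator T -> orbit_union (orbit_of T phi).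
Proof.
move=> bT; exists 1, (fun=> phi), (fun=> T); split=> //.
by apply/seteqP; split=> [x xT|x [_ _]//]; exists ord0.
Qed.

(** A single point is the orbit of the identity at that point. *)
Lemma orbit_union_finite S : finite_set S -> orbit_union S.
Proof.
move=> /finite_seqP[s ->]; elim: s => [|x s IHs].
  suff -> : [set` [::]] = set0 :> set H by exact: orbit_union0.
  by apply/seteqP; split.
have -> : [set` x :: s] = orbit_of idfun x `|` [set` s].
  have iter_id n : iter n idfun x = x by elim: n.
  apply/seteqP; split=> y /=.
    by rewrite inE => /orP[/eqP ->|]; [left; exists 0|right].
  rewrite inE => -[[n _ <-]|->]; last by rewrite orbT.
  by rewrite iter_id eqxx.
apply: orbit_unionU IHs; apply: orbit_union_single.
by exists 1 => y; rewrite mul1r.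
Qed.

End OrbitUnion.

(** * Norms and the inner product *)

Section InnerProduct.
Context {R : realType} {H : normedModType R[i]}.

Lemma rnormE (V : normedZmodType R[i]) (x : V) : (rnorm x)%:C = `|x|.
Proof. by rewrite /rnorm RRe_real// normr_real. Qed.

Lemma rnorm_ge0 (V : normedZmodType R[i]) (x : V) : 0 <= rnorm x.
Proof. by rewrite -ler0c rnormE. Qed.

Variable dot : {dot H for @Num.conj R[i]}.

Lemma dotC x y : dot y x = (dot x y)^*.
Proof. by rewrite hermC expr0 mul1r. Qed.

Lemma dot_suml n (c : 'I_n -> R[i]) (v : 'I_n -> H) y :
  dot (\sum_(i < n) c i *: v i) y = \sum_(i < n) c i * dot (v i) y.
Proof.
by rewrite linear_sumlz; apply: eq_bigr => i _; rewrite linearZl_LR.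
Qed.

Hypothesis dot_norm : forall x : H, dot x x = `|x| ^+ 2.

Lemma normB2 (x y : H) :
  `|x - y| ^+ 2 = `|x| ^+ 2 + `|y| ^+ 2 - (dot x y + (dot x y)^*).
Proof. by rewrite -!dot_norm dnormB. Qed.

End InnerProduct.

(** * From frame bounds to Riesz bounds *)

Section RieszBounds.
Context {R : realType} {H : normedModType R[i]}.
Variable dot : {dot H for @Num.conj R[i]}.
Hypothesis dot_norm : forall x : H, dot x x = `|x| ^+ 2.

(** With d_i = <x, v_i> for the sum x, one has |x|^2 = sum_i c_i (d_i)^*, so
    that expanding 0 <= sum_i |C2 c_i - d_i|^2 and bounding sum_i |d_i|^2 by
    C2 |x|^2 gives the claim. *)
Lemma bessel_synthesis n (v : 'I_n -> H) (C2 : R[i]) (c : 'I_n -> R[i]) :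
    0 < C2 -> (forall h, \sum_(i < n) `|dot h (v i)| ^+ 2 <= C2 * `|h| ^+ 2) ->
  `|\sum_(i < n) c i *: v i| ^+ 2 <= C2 * \sum_(i < n) `|c i| ^+ 2.
Proof.
move=> C2_gt0 bessel; set x := \sum_(i < n) _; set S := \sum_(i < n) _.
have xE : `|x| ^+ 2 = \sum_(i < n) c i * (dot x (v i))^*.
  by rewrite -dot_norm {1}/x dot_suml; apply: eq_bigr => i _; rewrite dotC.
have xE' : `|x| ^+ 2 = \sum_(i < n) (c i)^* * dot x (v i).
  have /CrealP <- : `|x| ^+ 2 \is Num.real by rewrite realX// normr_real.
  rewrite xE rmorph_sum/=; apply: eq_bigr => i _.
  by rewrite rmorphM/= conjCK.
have : 0 <= \sum_(i < n) `|C2 * c i - dot x (v i)| ^+ 2.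
  by apply: sumr_ge0 => i _; rewrite exprn_ge0.
have -> : \sum_(i < n) `|C2 * c i - dot x (v i)| ^+ 2 =
    C2 ^+ 2 * S - 2 * C2 * `|x| ^+ 2 + \sum_(i < n) `|dot x (v i)| ^+ 2.
  have -> : 2 * C2 * `|x| ^+ 2 =
      \sum_(i < n) C2 * (c i * (dot x (v i))^* + (c i)^* * dot x (v i)).
    by rewrite -mulr_sumr big_split/= -xE -xE'; ring.
  rewrite /S mulr_sumr -sumrB -big_split/=.
  apply: eq_bigr => i _; rewrite !normCK rmorphB rmorphM/=.
  have /CrealP -> : C2 \is Num.real by rewrite gtr0_real.
  ring.
move=> /le_trans/(_ (lerD (lexx _) (bessel x))).
have -> : C2 ^+ 2 * S - 2 * C2 * `|x| ^+ 2 + C2 * `|x| ^+ 2 =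
  C2 * (C2 * S - `|x| ^+ 2) by ring.
by rewrite pmulr_rge0// subr_ge0.
Qed.

(** Solvability of the linear system given by the Gram matrix, which is
    injective because its quadratic form at a is |sum_i a_i v_i|^2. *)
Lemma dual_vector n (v : 'I_n -> H) (c : 'I_n -> R[i]) :
    (forall a : 'I_n -> R[i],
      \sum_(i < n) a i *: v i = 0 -> forall i, a i = 0) ->
  exists a : 'I_n -> R[i], forall j, dot (\sum_(i < n) a i *: v i) (v j) = c j.
Proof.
move=> v_free; pose G := \matrix_(i < n, j < n) dot (v i) (v j).
have aG (a : 'rV_n) j : (a *m G) 0 j = dot (\sum_(i < n) a 0 i *: v i) (v j).
  by rewrite mxE dot_suml; apply: eq_bigr => i _; rewrite mxE.
have G_unit : G \in unitmx.
  rewrite -row_free_unit; apply: inj_row_free => a a0.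
  apply/rowP => i; rewrite mxE; apply: (v_free (a 0)).
  set x := \sum_(i < n) _; apply/eqP; rewrite -(dnorm_eq0 dot).
  rewrite {1}/x dot_suml big1// => j _.
  by rewrite dotC -aG a0 mxE rmorph0 mulr0.
exists (((\row_j c j) *m invmx G) 0) => j.
by rewrite -aG mulmxKV// mxE.
Qed.

(** Let x be the sum and choose y in the span with <y, v_i> = c_i. Then
    S = sum_i |c_i|^2 equals <x, y>, and the lower frame bound at y says
    C1 |y|^2 <= S. Expanding 0 <= |x - C1 y|^2 gives C1 S <= |x|^2. *)
Lemma free_lower_riesz n (v : 'I_n -> H) (C1 : R[i]) (c : 'I_n -> R[i]) :
    0 < C1 ->
    (forall a : 'I_n -> R[i],
      \sum_(i < n) a i *: v i = 0 -> forall i, a i = 0) ->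
    (forall h, lspan (range v) h ->
      C1 * `|h| ^+ 2 <= \sum_(i < n) `|dot h (v i)| ^+ 2) ->
  C1 * \sum_(i < n) `|c i| ^+ 2 <= `|\sum_(i < n) c i *: v i| ^+ 2.
Proof.
move=> C1_gt0 v_free lower; have [a yc] := dual_vector c v_free.
set y := \sum_(i < n) a i *: v i in yc.
have /lower : lspan (range v) y by exists n, a, v; split=> // i; exists i.
under eq_bigr do rewrite yc.
set S := \sum_(i < n) _; set x := \sum_(i < n) _ => yS.
have xyS : dot x y = S.
  by rewrite dot_suml; apply: eq_bigr => i _; rewrite dotC yc normCK.
have SR : S^* = S.
  by apply/CrealP/ger0_real/sumr_ge0 => i _; rewrite exprn_ge0.
have C1R : C1^* = C1 by apply/CrealP/gtr0_real.
have : 0 <= `|x - C1 *: y| ^+ 2 by rewrite exprn_ge0.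
rewrite (normB2 dot_norm) linearZr_LR/= C1R xyS rmorphM/= C1R SR.
rewrite normrZ exprMn gtr0_norm//.
have -> : `|x| ^+ 2 + C1 ^+ 2 * `|y| ^+ 2 - (C1 * S + C1 * S) =
   (`|x| ^+ 2 - C1 * S) - C1 * (S - C1 * `|y| ^+ 2) by ring.
rewrite subr_ge0 => le; rewrite -subr_ge0; apply: le_trans le.
by rewrite pmulr_rge0// subr_ge0.
Qed.

End RieszBounds.

(** * Extending a bounded linear relation to a bounded operator *)

Section Factorization.
Context {R : realType} {H : completeNormedModType R[i]}.
Variable dot : {dot H for @Num.conj R[i]}.
Hypothesis dot_norm : forall x : H, dot x x = `|x| ^+ 2.

Variables (U : lmodType R[i]) (A B : {linear U -> H}) (p : nat -> U) (K : R).
Hypothesis K_gt0 : 0 < K.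
Hypothesis leBA : forall u, `|B u| <= K%:C * `|A u|.

(* Gram-Schmidt for the semi-inner product <A u, A v> on U. As 0^-1 = 0, a
   vector w with A w = 0 is normalized to 0, so the images under A of the
   resulting vectors are an orthonormal system interspersed with zeros. *)
Let normalize (w : U) : U := `|A w|^-1 *: w.

(** The list of the first n Gram-Schmidt vectors, so that the recursion has all
    the earlier ones at hand. *)
Fixpoint gs_seq n : seq U :=
  if n is m.+1 then
    let s := gs_seq m in
    rcons s (normalize (p m - \sum_(q <- s) dot (A (p m)) (A q) *: q))
  else [::].

Let q n := nth 0 (gs_seq n.+1) n.
Let e n := A (q n).

Let size_gs n : size (gs_seq n) = n.
Proof. by elim: n => //= n IHn; rewrite size_rcons IHn. Qed.

Let gs_mkseq n : gs_seq n = mkseq q n.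
Proof.
elim: n => // n IHn; rewrite mkseqS -IHn/=; congr rcons.
by rewrite /q /= nth_rcons size_gs ltnn eqxx.
Qed.

Let w n := p n - \sum_(0 <= i < n) dot (A (p n)) (e i) *: q i.

Let qE n : q n = normalize (w n).
Proof.
rewrite {1}/q /= nth_rcons size_gs ltnn eqxx gs_mkseq.
by rewrite /w big_map /index_iota subn0.
Qed.

Let Aw_expand n :
  A (w n) = A (p n) - \sum_(0 <= i < n) dot (A (p n)) (e i) *: e i.
Proof.
rewrite /w linearB linear_sum/=; congr (_ - _).
by apply: eq_bigr => i _; rewrite linearZ.
Qed.

Let eE n : e n = `|A (w n)|^-1 *: A (w n).
Proof. by rewrite /e qE /normalize linearZ. Qed.

Let AwE n : A (w n) = `|A (w n)| *: e n.
Proof.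
rewrite eE scalerA; have [->|Aw] := eqVneq (A (w n)) 0.
  by rewrite scaler0.
by rewrite divff ?normr_eq0// scale1r.
Qed.

Let e_unit n : e n = 0 \/ dot (e n) (e n) = 1.
Proof.
rewrite dot_norm eE normrZ normfV normr_id.
have [->|Aw] := eqVneq (A (w n)) 0; first by left; rewrite scaler0.
by right; rewrite mulVf ?normr_eq0// expr1n.
Qed.

Let e_proj n x : dot x (e n) * dot (e n) (e n) = dot x (e n).
Proof.
by case: (e_unit n) => ->; rewrite ?linear0r ?mulr1// mulr0.
Qed.

Let e_orth_lt n : forall i, (i < n)%N -> dot (e n) (e i) = 0.
Proof.
elim/ltn_ind: n => n IHn i ilen.
rewrite (eE n) linearZl_LR/=.
suff -> : dot (A (w n)) (e i) = 0 by rewrite mulr0.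
rewrite Aw_expand linearBl.
rewrite linear_sumlz (big_rem i) ?mem_index_iota//=.
rewrite linearZl_LR/= e_proj big1_seq ?addr0 ?subrr//.
move=> j /andP[_]; rewrite mem_rem_uniq ?iota_uniq// !inE mem_index_iota.
move=> /and3P[ji _ jn]; rewrite linearZl_LR/=.
suff -> : dot (e j) (e i) = 0 by rewrite mulr0.
have [/(IHn _ jn)//|ij|ij] := ltngtP i j; last by rewrite ij eqxx in ji.
by rewrite dotC IHn// rmorph0.
Qed.

Let e_orth i j : i != j -> dot (e i) (e j) = 0.
Proof.
by rewrite neq_ltn => /orP[ij|/e_orth_lt//]; rewrite dotC e_orth_lt ?rmorph0.
Qed.

Let pythagoras m n (b : nat -> R[i]) :
  `|\sum_(m <= i < n) b i *: e i| ^+ 2 =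
  \sum_(m <= i < n) `|b i| ^+ 2 * dot (e i) (e i).
Proof.
rewrite -dot_norm linear_sumlz; apply: eq_big_nat => i imn.
rewrite linear_sumr (big_rem i) ?mem_index_iota//= big1_seq ?addr0.
  by rewrite linearZl_LR/= linearZr_LR/= normCK mulrA.
move=> j /andP[_]; rewrite mem_rem_uniq ?iota_uniq// !inE => /andP[ji _].
by rewrite linearZl_LR/= linearZr_LR/= e_orth 1?eq_sym// !mulr0.
Qed.

(* The weight <e i, e i> is 1 unless e i = 0, and then <h, e i> = 0 too. *)
Let proj_norm m n h :
  `|\sum_(m <= i < n) dot h (e i) *: e i| ^+ 2 =
  \sum_(m <= i < n) `|dot h (e i)| ^+ 2.
Proof.
rewrite pythagoras; apply: eq_bigr => i _.
by rewrite normCK mulrAC e_proj.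
Qed.

Let bessel n h : \sum_(0 <= i < n) `|dot h (e i)| ^+ 2 <= `|h| ^+ 2.
Proof.
set P := \sum_(0 <= i < n) dot h (e i) *: e i.
have hP : dot h P = \sum_(0 <= i < n) `|dot h (e i)| ^+ 2.
  rewrite linear_sumr; apply: eq_bigr => i _.
  by rewrite linearZr_LR/= normCK mulrC.
have : 0 <= `|h - P| ^+ 2 by rewrite exprn_ge0.
rewrite (normB2 dot_norm) proj_norm -hP.
have -> : (dot h P)^* = dot h P.
  by rewrite hP; apply/CrealP/ger0_real/sumr_ge0 => i _; rewrite exprn_ge0.
by rewrite opprD addrA addrK subr_ge0 hP.
Qed.

(* The operator is h |-> sum_i <h, e i> B (q i): project onto the closed
   span of the A (p n), then apply the map that B induces there. *)
Let Tterm h i := dot h (e i) *: B (q i).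

Let Tterm_le m n h :
  `|\sum_(m <= i < n) Tterm h i| <=
  K%:C * `|\sum_(m <= i < n) dot h (e i) *: e i|.
Proof.
have -> : \sum_(m <= i < n) Tterm h i =
    B (\sum_(m <= i < n) dot h (e i) *: q i).
  by rewrite linear_sum; apply: eq_bigr => i _; rewrite linearZ.
apply: le_trans (leBA _) _; rewrite linear_sum/=.
by under eq_bigr do rewrite linearZ.
Qed.

Let K0C : 0 < K%:C :> R[i]. Proof. by rewrite ltcR. Qed.

(* By Bessel the series of the |<h, e i>|^2 converges, and its tails control
   those of the vector series. *)
Let Tterm_cvg h : cvgn (series (Tterm h)).
Proof.
have /cauchy_cvgP/cauchy_seriesP bcvg :
    cvgn (series (fun i => rnorm (dot h (e i)) ^+ 2)).
  apply: nondecreasing_is_cvgn.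
    by apply: nondecreasing_series => i _ _; rewrite exprn_ge0 ?rnorm_ge0.
  exists (rnorm h ^+ 2) => _ [n _ <-].
  rewrite -lecR /series/= rmorph_sum/= rmorphXn/= rnormE.
  under eq_bigr do rewrite rmorphXn/= rnormE.
  exact: bessel.
apply/cauchy_cvgP/cauchy_seriesP => eps eps0.
have epsE : eps = (complex.Re eps)%:C by rewrite RRe_real// gtr0_real.
have Reps0 : 0 < complex.Re eps by rewrite -ltcR -epsE.
have /bcvg : 0 < (complex.Re eps / K) ^+ 2 by rewrite exprn_gt0// divr_gt0.
apply: filterS => -[m n] /=; rewrite ger0_norm; last first.
  by apply: sumr_ge0 => i _; rewrite exprn_ge0 ?rnorm_ge0.
rewrite -ltcR rmorph_sum/=.
under eq_bigr do rewrite rmorphXn/= rnormE.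
rewrite -proj_norm rmorphXn/= ltr_pXn2r ?nnegrE//; last first.
  by rewrite ler0c divr_ge0// ltW.
move=> lt; apply: le_lt_trans (Tterm_le _ _ _) _.
by rewrite -ltr_pdivlMl// epsE mulrC -fmorphV -rmorphM.
Qed.

Let Tfun h : H := lim (series (Tterm h) @ \oo).

Let Tfun_linear : linear Tfun.
Proof.
move=> a x y; apply: cvg_lim => //.
have -> : series (Tterm (a *: x + y)) =
    (fun n => a *: series (Tterm x) n + series (Tterm y) n).
  apply/funext => n; rewrite /series/= scaler_sumr -big_split/=.
  apply: eq_bigr => i _; rewrite /Tterm linearDl linearZl_LR/=.
  by rewrite scalerDl scalerA.
by apply: cvgD; [apply: cvgZr|]; exact: Tterm_cvg.
Qed.

Let Tfun_le h : `|Tfun h| <= K%:C * `|h|.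
Proof.
apply/ler_addgt0Pr => eps eps0.
have /cvgrPdist_lt/(_ _ eps0)[n _ /(_ n (leqnn n))/= Tn] :
  series (Tterm h) @ \oo --> Tfun h by exact: Tterm_cvg.
rewrite -[Tfun h](subrK (series (Tterm h) n)) addrC.
apply: le_trans (ler_normD _ _) _; apply: lerD (ltW Tn).
apply: le_trans (Tterm_le _ _ _) _; rewrite ler_pM2l//.
rewrite -(@ler_pXn2r _ 2) ?nnegrE// proj_norm.
exact: bessel.
Qed.

Let Ap_expand n : A (p n) = \sum_(0 <= i < n.+1) dot (A (p n)) (e i) *: e i.
Proof.
have pE : A (p n) = A (w n) + \sum_(0 <= i < n) dot (A (p n)) (e i) *: e i.
  by rewrite Aw_expand subrK.
rewrite big_nat_recr//= addrC {1}pE; congr (_ + _).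
suff : dot (A (w n)) (e n) = dot (A (p n)) (e n).
  rewrite AwE linearZl_LR/= => <-.
  by case: (e_unit n) => ->; rewrite ?mulr1// !scaler0.
rewrite [in RHS]pE linearDl linear_sumlz big1_seq ?addr0// => i /andP[_].
rewrite mem_index_iota => /andP[_ ilen].
by rewrite linearZl_LR/= e_orth ?mulr0// ltn_eqF.
Qed.

Let Tfun_p n : Tfun (A (p n)) = B (p n).
Proof.
(* The difference of the two sides is B at a vector that A annihilates. *)
have Bp : B (p n) = \sum_(0 <= i < n.+1) Tterm (A (p n)) i.
  apply/eqP; rewrite -subr_eq0 -normr_le0.
  have -> : B (p n) - \sum_(0 <= i < n.+1) Tterm (A (p n)) i =
      B (p n - \sum_(0 <= i < n.+1) dot (A (p n)) (e i) *: q i).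
    rewrite linearB [B (\sum_(_ <= _ < _) _)]linear_sum; congr (_ - _).
    by apply: eq_bigr => i _; rewrite linearZ.
  apply: le_trans (leBA _) _; rewrite linearB.
  rewrite [A (\sum_(_ <= _ < _) _)]linear_sum/=.
  under [X in _ - X]eq_bigr do rewrite linearZ/=.
  by rewrite -Ap_expand subrr normr0 mulr0.
apply: cvg_lim => //; apply: cvg_near_cst; exists n.+1 => // m /= nm.
rewrite /series/= (@big_cat_nat _ _ _ n.+1)//= -Bp.
rewrite [X in _ + X]big1_seq ?addr0//.
move=> i /andP[_]; rewrite mem_index_iota => /andP[ni _].
rewrite /Tterm Ap_expand linear_sumlz big1_seq ?scale0r// => j /andP[_].
rewrite mem_index_iota => /andP[_ jn].
by rewrite linearZl_LR/= e_orth ?mulr0// ltn_eqF// (leq_trans jn).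
Qed.

(** The bound of B by A makes A u |-> B u a well-defined bounded map on the
    range of A. From the span of the A (p n) it extends to the closure by
    continuity, and to H through the orthogonal projection; an expansion in the
    Gram-Schmidt system of the A (p n) does both at once. *)
Lemma bounded_factorization :
  exists2 T : {linear H -> H}, bounded_operator T &
    forall n, T (A (p n)) = B (p n).
Proof.
pose mixT := GRing.isLinear.Build R[i] H H *:%R Tfun Tfun_linear.
pose T : {linear H -> H} := HB.pack Tfun mixT.
exists T; last exact: Tfun_p.
by exists K => h; rewrite -lecR rmorphM/= !rnormE; exact: Tfun_le.
Qed.

End Factorization.

(** * Finite combinations of a sequence of vectors *)

Section CoefficientMap.
Context {R : realType} {H : normedModType R[i]}.
Variable F : nat -> H.

(** Polynomials serve as the free vector space on the natural numbers: 'X^n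
    stands for the n-th basis vector. *)
Definition poly_comb (p : {poly R[i]}) : H := \sum_(i < size p) p`_i *: F i.

Lemma poly_comb_widen n (p : {poly R[i]}) :
  (size p <= n)%N -> poly_comb p = \sum_(i < n) p`_i *: F i.
Proof.
move=> pn; rewrite /poly_comb (big_ord_widen n (fun i => p`_i *: F i) pn).
rewrite big_mkcond; apply: eq_bigr => i _; case: ltnP => // pi.
by rewrite nth_default// scale0r.
Qed.

Lemma poly_comb_linear : linear poly_comb.
Proof.
move=> a p q; pose n := maxn (size (a *: p + q)) (maxn (size p) (size q)).
rewrite !(@poly_comb_widen n) ?leq_max ?leqnn ?orbT// scaler_sumr -big_split.
by apply: eq_bigr => i _; rewrite coefD coefZ scalerDl scalerA.
Qed.

HB.instance Definition _ :=
  GRing.isLinear.Build R[i] {poly R[i]} H *:%R poly_comb poly_comb_linear.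

Lemma poly_combXn n : poly_comb 'X^n = F n.
Proof.
rewrite (@poly_comb_widen n.+1) ?size_polyXn// big_ord_recr/= coefXn eqxx.
rewrite scale1r big1 ?add0r// => i _.
by rewrite coefXn ltn_eqF// scale0r.
Qed.

End CoefficientMap.

(** * Riesz frames *)

Lemma esum_range (R : realType) (I : choiceType) n (k : 'I_n -> I)
    (a : I -> R) :
    injective k -> (forall i, 0 <= a i) ->
  \esum_(i in range k) (a i)%:E = (\sum_(i < n) a (k i))%:E.
Proof.
move=> k_inj a_ge0; rewrite esum_image; last by move=> i j _ _; exact: k_inj.
rewrite (esum_fset (@finite_finset _ _)); last by move=> i _; rewrite lee_fin.
rewrite (fsbigE (index_enum 'I_n)) ?index_enum_uniq//; last first.
  by move=> i _; rewrite mem_index_enum.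
by rewrite -sumEFin; apply: eq_bigl => i; rewrite in_setT.
Qed.

Section RieszFrame.
Context {R : realType} {H : completeNormedModType R[i]}.
Variable dot : {dot H for @Num.conj R[i]}.
Hypothesis dot_norm : forall x : H, dot x x = `|x| ^+ 2.
Context {I : countType} {f : I -> H} {C1 C2 : R}.
Hypotheses (C1_gt0 : 0 < C1) (C2_gt0 : 0 < C2).
Hypothesis lower : forall (J : set I) (h : H), lspan (f @` J) h ->
  ((C1 * rnorm h ^+ 2)%:E <= \esum_(n in J) (rnorm (dot h (f n)) ^+ 2)%:E)%E.
Hypothesis upper : forall h : H,
  (\esum_(n in [set: I]) (rnorm (dot h (f n)) ^+ 2)%:E
     <= (C2 * rnorm h ^+ 2)%:E)%E.

Let coef h n := (rnorm (dot h (f n)) ^+ 2)%:E.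

Let coef_ge0 h n : (0 <= coef h n)%E.
Proof. by rewrite lee_fin exprn_ge0 ?rnorm_ge0. Qed.

Let le_esumT (J : set I) h :
  (\esum_(n in J) coef h n <= \esum_(n in [set: I]) coef h n)%E.
Proof.
rewrite (esumID J setT)// setTI; apply: leeDl.
exact: esum_ge0.
Qed.

Lemma upper_fin n (k : 'I_n -> I) h : injective k ->
  \sum_(i < n) `|dot h (f (k i))| ^+ 2 <= C2%:C * `|h| ^+ 2.
Proof.
move=> k_inj; have := le_trans (le_esumT (range k) h) (upper h).
rewrite esum_range ?lee_fin//; last by move=> i; rewrite exprn_ge0 ?rnorm_ge0.
rewrite -lecR rmorph_sum/= rmorphM/= rmorphXn/= rnormE.
by under eq_bigr do rewrite rmorphXn/= rnormE.
Qed.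

Lemma lower_fin n (k : 'I_n -> I) h : injective k ->
    lspan (range (f \o k)) h ->
  C1%:C * `|h| ^+ 2 <= \sum_(i < n) `|dot h (f (k i))| ^+ 2.
Proof.
move=> k_inj; rewrite -(image_comp k f) => h_span; have := lower h_span.
rewrite esum_range ?lee_fin//; last by move=> i; rewrite exprn_ge0 ?rnorm_ge0.
rewrite -lecR rmorph_sum/= rmorphM/= rmorphXn/= rnormE.
by under eq_bigr do rewrite rmorphXn/= rnormE.
Qed.

(** An infinite sieve carries the shift along an enumeration, which the Riesz
    bounds make bounded; the first vector generates all of it. *)
Lemma sieve_orbit (J : set I) : orbit_union (f @` sieve f J).
Proof.
have [/finite_image|sieve_inf] := pselect (finite_set (sieve f J)).
  by move=> /(_ _ f); exact: orbit_union_finite.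
have [g [g_inj g_range]] : exists g : nat -> I, injective g /\
    range g = sieve f J.
  have := eq_card_nat (countableP (sieve f J)) sieve_inf.
  rewrite card_eq_sym => /card_bijP[u [v uK vK]].
  exists (fun n => val (u (to_setT n))); split.
    by move=> m n /val_inj/(can_inj uK)/(congr1 val).
  apply/seteqP; split=> [_ [n _ <-]|i /mem_set iJ]; first exact/set_mem/valP.
  exists (val (v (SigSub iJ))) => //.
  suff -> : to_setT (val (v (SigSub iJ))) = v (SigSub iJ) by rewrite vK.
  exact: val_inj.
have gJ n : sieve f J (g n) by rewrite -g_range; exists n.
have ratio_gt0 : 0 < Num.sqrt (C2 / C1) by rewrite sqrtr_gt0 divr_gt0.
have shift_le (p : {poly R[i]}) : `|poly_comb (f \o g \o succn) p| <=
    (Num.sqrt (C2 / C1))%:C * `|poly_comb (f \o g) p|.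
  rewrite -(@ler_pXn2r _ 2) ?nnegrE ?mulr_ge0 ?ler0c ?sqrtr_ge0//.
  rewrite exprMn -rmorphXn/= sqr_sqrtr; last by rewrite divr_ge0 ?ltW.
  rewrite rmorphM/= fmorphV [_ * _^-1]mulrC -mulrA ler_pdivlMl ?ltcR//.
  set S := \sum_(i < size p) `|p`_i| ^+ 2.
  apply: (@le_trans _ _ (C1%:C * (C2%:C * S))).
    rewrite ler_pM2l ?ltcR//.
    apply: (@bessel_synthesis _ _ _ dot_norm _ (f \o g \o succn \o val)).
      by rewrite ltcR.
    by move=> h; apply: upper_fin => i j /g_inj/succn_inj/val_inj.
  rewrite mulrCA ler_pM2l ?ltcR//.
  apply: (@free_lower_riesz _ _ _ dot_norm _ (f \o g \o val)).
  - by rewrite ltcR.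
  - move=> c; apply: (@sieve_free _ _ _ f J _ (g \o val)) => [i j|i].
      by move/g_inj/val_inj.
    exact: gJ.
  - by move=> h; apply: lower_fin => i j /g_inj/val_inj.
have [T bT Tg] := bounded_factorization dot_norm
  (fun n => 'X^n : {poly R[i]}) ratio_gt0 shift_le.
have {}Tg n : T (f (g n)) = f (g n.+1).
  by have := Tg n; rewrite /= !poly_combXn.
have -> : f @` sieve f J = orbit_of T (f (g 0)).
  have gT n : iter n T (f (g 0)) = f (g n) by elim: n => //= n ->.
  rewrite -g_range image_comp; apply/seteqP.
  by split=> _ [n _ <-]; exists n; rewrite //= gT.
exact: orbit_union_single.
Qed.

Fixpoint residue (m : nat) : set I :=
  if m is m'.+1 then residue m' `\` sieve f (residue m') else [set: I].

(** f k lies in the span of each of the m disjoint sieves removed so far, so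
    each of them contributes at least C1 |f k|^2 to the frame sum of f k. *)
Lemma residue_count m k : residue m k ->
  ((m%:R * (C1 * rnorm (f k) ^+ 2))%:E + \esum_(n in residue m) coef (f k) n
     <= \esum_(n in [set: I]) coef (f k) n)%E.
Proof.
elim: m => [|m IHm]; first by rewrite mul0r add0e.
move=> /= [km _]; apply: le_trans (IHm km).
rewrite -natr1 mulrDl mul1r EFinD -addeA leeD2l//.
rewrite [in leRHS](esumID (sieve f (residue m)))//.
have -> : residue m `&` sieve f (residue m) = sieve f (residue m).
  by rewrite setIidr// => i [].
by apply: leeD => //; apply: lower; exact: sieve_span.
Qed.

Lemma residue_zero : exists M, forall k, residue M k -> f k = 0.
Proof.
exists (Num.bound (C2 / C1)) => k /residue_count.
have := archi_boundP (ltW (divr_gt0 C2_gt0 C1_gt0)).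
set M := Num.bound _; rewrite ltr_pdivrMr// => MB le.
apply/eqP; rewrite -normr_le0 -rnormE lecR leNgt.
apply/negP => fk; move: (le_trans le (upper _)).
rewrite leNgt => /negP; apply; apply: lt_le_trans (leeDl _ _).
  by rewrite lte_fin mulrA ltr_pM2r// exprn_gt0.
exact: esum_ge0.
Qed.

Lemma range_orbit_union : orbit_union (range f).
Proof.
have [M fM] := residue_zero.
suff : forall m, (m <= M)%N -> orbit_union (f @` residue (M - m)).
  by move=> /(_ M (leqnn M)); rewrite subnn.
elim=> [_|m IHm mM].
  rewrite subn0; apply: orbit_union_finite.
  apply: (@sub_finite_set _ _ [set 0]) => //.
  by move=> _ [k /fM -> <-].
have -> : f @` residue (M - m.+1) =
    f @` sieve f (residue (M - m.+1)) `|` f @` residue (M - m).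
  rewrite -image_setU -(subnSK mM)/=; congr image.
  apply/seteqP; split=> [k|k [[]|[]]//].
  by have [kS|kS] := pselect (sieve f (residue (M - m.+1)) k); [left|right].
by apply: orbit_unionU; [exact: sieve_orbit|exact/IHm/ltnW].
Qed.

End RieszFrame.

Theorem proposition31 (R : realType) (H : completeNormedModType R[i])
    (dot : {dot H for @Num.conj R[i]})
    (dot_norm : forall x : H, dot x x = `|x| ^+ 2)
    (H_separable : separable_space H)
    (H_infinite : infinite_dimensional H)
    (I : countType) (f : I -> H)
    (f_riesz : riesz_frame dot f) :
  exists (N : nat) (phi : 'I_N -> H) (T : 'I_N -> {linear H -> H}),
    (forall i : 'I_N, bounded_operator (T i)) /\
    range f = \bigcup_(i in [set: 'I_N]) orbit_of (T i) (phi i).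
Proof.
(* The Bessel bound, at vectors that need not lie in the closed span of f, comes
   from the frame property; the uniform lower bound from the Riesz property. *)
have [[D1 [D2 [/andP[D1_gt0 D12] boundsT]]]] := f_riesz.
move=> [C1 [C2 [/andP[C1_gt0 _] bounds]]].
have D2_gt0 := lt_le_trans D1_gt0 D12.
apply: (range_orbit_union dot_norm C1_gt0 D2_gt0) => [J h hJ|h].
  by have [] := bounds J h (subset_closure hJ).
by have [] := boundsT h Logic.I.
Qed.
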